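(* Let $x>0$, $y>0$, $c\ge 1$, $d\ge 1$ be real numbers and let \begin{align*} f(c,d,x,y)=\;&(14-6\sqrt{5})(c^2xy^3+d^2x^3y+cdx^3y+cdxy^3+cx^3y+dxy^3)+(32-12\sqrt{5})(c^2x^2y^2+d^2x^2y^2)\\ &+(12\sqrt{5}-48)(c^2xy^2+d^2x^2y)+(12\sqrt{5}-24)(c^2x^2y+d^2xy^2)+(20\sqrt{5}-44)(cx^2y^3+dx^3y^2)\\ &+(28-12\sqrt{5})(cxy^3+dx^3y)+(10\sqrt{5}-22)(cx^3y^2+dx^2y^3)+(48-24\sqrt{5})(cx^2y^2+dx^2y^2)\\ &+(4+4\sqrt{5})(cxy^2+dx^2y)+(6\sqrt{5}-6)(c^3dx+cd^3y)+(6+2\sqrt{5})(c^3dy^2+cd^3x^2)\\ &+(2\sqrt{5}-26)(c^3dy+cd^3x)+(8\sqrt{5}-4)(c^3xy^2+d^3x^2y)+(18-6\sqrt{5})(c^3xy+d^3xy)\\ &+(6\sqrt{5}-30)(c^2d^2x+c^2d^2y)+(18-6\sqrt{5})(c^2dx^2+cd^2y^2)+(18-14\sqrt{5})(c^2dy^2+cd^2x^2)\\ &+(8+4\sqrt{5})(c^2dy+cd^2x)+(4\sqrt{5}-8)(cdx^3+cdy^3)+(4\sqrt{5}-8)(c^2y^3+d^2x^3)\\ &+(6+2\sqrt{5})(c^2y^2+d^2x^2)+(10\sqrt{5}-22)(x^3y^2+x^2y^3)+(6+2\sqrt{5})(c^4y^2+d^4x^2)\\ &+(2\sqrt{5}-2)(c^4y+d^4x)+(8\sqrt{5}-16)(c^2dx^2y+cd^2xy^2)+(14\sqrt{5}-22)(c^2dxy^2+cd^2x^2y)\\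 &+(36-36\sqrt{5})(c^2dxy+cd^2xy)+(6-2\sqrt{5})(c^3dxy+cd^3xy)+(28\sqrt{5}-80)(cdx^2y+cdxy^2)\\ &+12(c^3d^2+c^2d^3)+4(c^4d+cd^4)-8\sqrt{5}(c^3y^2+d^3x^2)+4x^2y^2+(18+6\sqrt{5})cdxy\\ &+(12-4\sqrt{5})c^2d^2xy+(36-16\sqrt{5})x^3y^3+(70-30\sqrt{5})cdx^2y^2. \end{align*} Then $f(c,d,x,y)\ge 0$, with equality if and only if $c=d=x=y=1$. *)

(* Defs.v *)
From Stdlib Require Import Reals Lra.
Open Scope R_scope.

Definition f4p2 (c d x y : R) : R :=
  let s := sqrt 5 in
    (14 - 6*s) * (c^2*x*y^3 + d^2*x^3*y + c*d*x^3*y + c*d*x*y^3 + c*x^3*y + d*x*y^3)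
  + (32 - 12*s) * (c^2*x^2*y^2 + d^2*x^2*y^2)
  + (12*s - 48) * (c^2*x*y^2 + d^2*x^2*y)
  + (12*s - 24) * (c^2*x^2*y + d^2*x*y^2)
  + (20*s - 44) * (c*x^2*y^3 + d*x^3*y^2)
  + (28 - 12*s) * (c*x*y^3 + d*x^3*y)
  + (10*s - 22) * (c*x^3*y^2 + d*x^2*y^3)
  + (48 - 24*s) * (c*x^2*y^2 + d*x^2*y^2)
  + (4 + 4*s) * (c*x*y^2 + d*x^2*y)
  + (6*s - 6) * (c^3*d*x + c*d^3*y)
  + (6 + 2*s) * (c^3*d*y^2 + c*d^3*x^2)
  + (2*s - 26) * (c^3*d*y + c*d^3*x)
  + (8*s - 4) * (c^3*x*y^2 + d^3*x^2*y)
  + (18 - 6*s) * (c^3*x*y + d^3*x*y)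
  + (6*s - 30) * (c^2*d^2*x + c^2*d^2*y)
  + (18 - 6*s) * (c^2*d*x^2 + c*d^2*y^2)
  + (18 - 14*s) * (c^2*d*y^2 + c*d^2*x^2)
  + (8 + 4*s) * (c^2*d*y + c*d^2*x)
  + (4*s - 8) * (c*d*x^3 + c*d*y^3)
  + (4*s - 8) * (c^2*y^3 + d^2*x^3)
  + (6 + 2*s) * (c^2*y^2 + d^2*x^2)
  + (10*s - 22) * (x^3*y^2 + x^2*y^3)
  + (6 + 2*s) * (c^4*y^2 + d^4*x^2)
  + (2*s - 2) * (c^4*y + d^4*x)
  + (8*s - 16) * (c^2*d*x^2*y + c*d^2*x*y^2)
  + (14*s - 22) * (c^2*d*x*y^2 + c*d^2*x^2*y)
  + (36 - 36*s) * (c^2*d*x*y + c*d^2*x*y)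
  + (6 - 2*s) * (c^3*d*x*y + c*d^3*x*y)
  + (28*s - 80) * (c*d*x^2*y + c*d*x*y^2)
  + 12 * (c^3*d^2 + c^2*d^3)
  + 4 * (c^4*d + c*d^4)
  - 8*s * (c^3*y^2 + d^3*x^2)
  + 4 * x^2*y^2
  + (18 + 6*s) * c*d*x*y
  + (12 - 4*s) * c^2*d^2*x*y
  + (36 - 16*s) * x^3*y^3
  + (70 - 30*s) * c*d*x^2*y^2.

(* Main.v *)
Require Import Defs.
From Stdlib Require Import Reals Lra.
Open Scope R_scope.

(** Both [f] and its gradient vanish at [c = d = x = y = 1] when [sqrt 5] is
    replaced by an arbitrary parameter [s], so [f] can be sought as a combination
    of squares of forms vanishing there, with coefficients affine in [s] that are
    nonnegative near [sqrt 5].  Such a combination exists, with weights that are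
    products of [c], [d], [x], [y] and at most one factor [c - 1] or [d - 1]; it was
    found by linear programming over squares of forms with small integer
    coefficients.  As [f] is invariant under [(c, x) <-> (d, y)], only one square
    of each symmetric pair is listed, and adding the swapped copies gives [2 f]. *)

Definition definite_squares (s c d x y : R) : R :=
    (2 * s - 4) * x^2 * y^2 * (1 - c)^2
  + (94 - 42 * s) * x * y * (x * y - c * d)^2
  + (61 / 2 * s - 67) * c * d^2 * (x - d)^2
  + (164 / 3 - 67 / 3 * s) * c * x * (y - d)^2.

Definition remaining_squares (s c d x y : R) : R :=
    (8 - 2 * s) * y^2 * (c + x - c^2 - d * x)^2
  + (5 * s - 3) * (c * y + d * x - c^2 * y - d^2 * x)^2
  + (10 - 4 * s) * (2 * c * y + d * x - c^2 * y - 2 * d * x * y)^2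
  + (2 * s - 4) * x * (d * x + 2 * x * y - 2 * d^2 - d * y)^2
  + (6 * s - 12) * x * (2 * c * y + d * x - d^2 - 2 * d * y)^2
  + (24 - 10 * s) * x * (c * y + d^2 - c * d - d * y)^2
  + (26 * s - 58) * x * y * (c * y + x * y - 2 * c * d)^2
  + (43 - 19 * s) * x * y * (c * y + d * x - 2 * c * d)^2
  + (32 - 14 * s) * c * (c * y + d * x - d^2 - d * y)^2
  + (3 - 1 / 2 * s) * c * (2 * c * y + d * x - d^2 - 2 * d * y)^2
  + (12 * s - 24) * c * (2 * c * y + d * x - 2 * c * d - d * y)^2
  + (40 - 16 * s) * c * (c * y + d * x - c * d - d^2)^2
  + (22 * s - 49) * c * x * (x * y + y - 2 * d)^2
  + (100 / 3 - 85 / 6 * s) * c * x * (d * y + y - 2 * d)^2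
  + (5 - 2 * s) * c * x * (2 * d + y - 2 * c * y - x * y)^2
  + (8 - 3 / 2 * s) * c * x * (2 * d + y - 2 * c * y - d * y)^2
  + (17 * s - 32) * c * x * y^2 * (1 - c)^2
  + (13 * s - 28) * c * x * (d + y - c * y - d * y)^2
  + (18 - 8 * s) * c * x * y * (x - d)^2
  + (28 / 3 * s - 62 / 3) * c * x * y * (2 * x + y - 2 * c - d)^2
  + (101 - 45 * s) * c * x * y * (x + y - c - d)^2
  + (138 - 60 * s) * c * x * y * (c - d)^2
  + (2 * s - 4) * c * d * x * (2 * x + y - c - 2 * d)^2
  + (40 * s - 84) * c * d * x * (c - d)^2
  + (8 / 3 * s - 16 / 3) * c * d * x * y * (x + 1 - 2 * c)^2
  + (25 / 3 - 11 / 3 * s) * c * d * x * y * (x + y - c - d)^2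
  + (20 - 8 * s) * (c - 1) * (d * x - c * y)^2
  + (28 - 12 * s) * (c - 1) * x^2 * y * (y - d)^2
  + (4 * s - 4) * (c - 1) * d * x^2 * (y - d)^2
  + 8 * (c - 1) * d * (d * x - c * y)^2
  + (25 / 3 - 11 / 3 * s) * (c - 1) * d * x * y * (c + y - d - x)^2.

(** The weights leave little room: [26 * s - 58] requires s >= 29/13 = 2.2307..., and [94 - 42 * s]
    requires s < 47/21 = 2.2380... *)
Lemma sqrt5_bounds : 2236 / 1000 < sqrt 5 < 22361 / 10000.
Proof.
  assert (H := sqrt_sqrt 5 ltac:(lra)).
  assert (H0 := sqrt_pos 5).
  split; nra.
Qed.

(* The identity holds with any real in place of [sqrt 5]. *)
Lemma f4p2_decomposition (c d x y : R) :
  let s := sqrt 5 in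
  2 * f4p2 c d x y =
    (definite_squares s c d x y + definite_squares s d c y x)
    + (remaining_squares s c d x y + remaining_squares s d c y x).
Proof. unfold f4p2, definite_squares, remaining_squares; cbv zeta; field. Qed.

(** [lra] comes before the splitting rules so that differences such as [5 * s - 3] or [c - 1] are
    settled whole. *)
Ltac nonneg :=
  repeat first [ apply pow2_ge_0 | lra | apply Rplus_le_le_0_compat | apply Rmult_le_pos ].

Lemma definite_squares_ge0 (s c d x y : R) :
  2236 / 1000 < s < 22361 / 10000 -> 0 < x -> 0 < y -> 1 <= c -> 1 <= d ->
  0 <= definite_squares s c d x y.
Proof. intros; unfold definite_squares; nonneg. Qed.

Lemma remaining_squares_ge0 (s c d x y : R) :
  2236 / 1000 < s < 22361 / 10000 -> 0 < x -> 0 < y -> 1 <= c -> 1 <= d ->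
  0 <= remaining_squares s c d x y.
Proof. intros; unfold remaining_squares; nonneg. Qed.

Lemma Rmult_pow2_eq0 (a z : R) : 0 < a -> a * z^2 = 0 -> z = 0.
Proof.
  intros ha h.
  destruct (Rmult_integral _ _ h) as [h0 | h0]; [lra |].
  apply Rsqr_0_uniq; unfold Rsqr; lra.
Qed.

(** All four weights are strictly positive, so c = 1, x = y = d and xy = cd; hence d^2 = d with d >
    0. *)
Lemma definite_squares_eq0 (s c d x y : R) :
  2236 / 1000 < s < 22361 / 10000 -> 0 < x -> 0 < y -> 1 <= c -> 1 <= d ->
  definite_squares s c d x y = 0 -> c = 1 /\ d = 1 /\ x = 1 /\ y = 1.
Proof.
  intros hs hx hy hc hd; unfold definite_squares.
  match goal with |- ?t1 * ?q1 + ?t2 * ?q2 + ?t3 * ?q3 + ?t4 * ?q4 = 0 -> _ =>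
    assert (0 < t1 /\ 0 < t2 /\ 0 < t3 /\ 0 < t4) as (p1 & p2 & p3 & p4)
      by (repeat split; repeat first [ lra | apply pow_lt | apply Rmult_lt_0_compat ]);
    assert (0 <= t1 * q1) by nonneg; assert (0 <= t2 * q2) by nonneg;
    assert (0 <= t3 * q3) by nonneg; assert (0 <= t4 * q4) by nonneg;
    intro h;
    assert (t1 * q1 = 0) as h1 by lra; assert (t2 * q2 = 0) as h2 by lra;
    assert (t3 * q3 = 0) as h3 by lra; assert (t4 * q4 = 0) as h4 by lra
  end.
  apply Rmult_pow2_eq0 in h1, h2, h3, h4; try assumption.
  assert (c = 1) by lra; assert (x = d) by lra; assert (y = d) by lra; subst.
  assert (d * (d - 1) = 0) as h5 by lra.
  destruct (Rmult_integral _ _ h5); repeat split; lra.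
Qed.

Theorem theorem4p2 (c d x y : R) (hx : 0 < x) (hy : 0 < y) (hc : 1 <= c) (hd : 1 <= d) :
  0 <= f4p2 c d x y /\
  (f4p2 c d x y = 0 <-> (c = 1 /\ d = 1 /\ x = 1 /\ y = 1)).
Proof.
  assert (hs := sqrt5_bounds).
  assert (H := f4p2_decomposition c d x y); cbv zeta in H.
  assert (hd1 := definite_squares_ge0 (sqrt 5) c d x y hs hx hy hc hd).
  assert (hd2 := definite_squares_ge0 (sqrt 5) d c y x hs hy hx hd hc).
  assert (hr1 := remaining_squares_ge0 (sqrt 5) c d x y hs hx hy hc hd).
  assert (hr2 := remaining_squares_ge0 (sqrt 5) d c y x hs hy hx hd hc).
  split; [lra | split].
  (* Four nonnegative terms sum to 2 * 0, so each vanishes; one copy of [definite_squares] is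
     enough. *)
  - intro h0; apply (definite_squares_eq0 (sqrt 5)); try assumption; lra.
  - intros (-> & -> & -> & ->); unfold f4p2; ring.
Qed.
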